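(* Let $\Gamma$ be a finite quiver, $(T,f)$ a top-representation of $\Gamma$, and let $(T',f),(T'',f)$ be sub-representations of $(T,f)$ such that $T(i)=T'(i)\cup T''(i)$ and $T'(i)\cap T''(i)=\emptyset$ for all $i\in\Gamma_0$. Let $L_1:(T',f)\to(T,f)$ and $L_2:(T'',f)\to(T,f)$ be the inclusions. Then: (i) $At^\Gamma(L_1)$ and $At^\Gamma(L_2)$ are injective, and $$At^\Gamma(T,f)=\operatorname{Im}At^\Gamma(L_1)\cup\operatorname{Im}At^\Gamma(L_2),\qquad \operatorname{Im}At^\Gamma(L_1)\cap\operatorname{Im}At^\Gamma(L_2)=\emptyset.$$ (ii) Furthermore, if $T'(i)$ is an open subset of $T(i)$ for each $i\in\Gamma_0$, then $At^\Gamma(T',f)\simeq\operatorname{Im}At^\Gamma(L_1)$ (homeomorphic).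
   Context: A quiver $\Gamma=(\Gamma_0,\Gamma_1)$ is an oriented graph; it is finite if $\Gamma_0$ and $\Gamma_1$ are finite. A top-representation $(T,f)$ of $\Gamma$ is a family of topological spaces $T(i)$, $i\in\Gamma_0$, with a continuous map $f_a:T(i)\to T(j)$ for each arrow $a:i\to j$. A sub-representation $(T',f)$ consists of subspaces $T'(i)\subseteq T(i)$ with $f_a(T'(i))\subseteq T'(j)$ for each arrow $a:i\to j$, with the restricted maps. A morphism of top-representations is a family of continuous maps at the vertices commuting with the structure maps. $At^\Gamma(T,f)$ is the quotient space of $\coprod_{i\in\Gamma_0}T(i)$ by the equivalence relation generated by $D=\{(x_i,x_j): x_i\in T(i),\ x_j\in T(j),\ f_a(x_i)=x_j\text{ for some arrow }a:i\to j\}$; the class of $x$ is $\overline x$. For a morphism $\alpha:(T,f)\to(U,g)$, $At^\Gamma(\alpha)$ is the induced continuous map $\overline x\mapsto\overline{\alpha_i(x)}$ for $x\in T(i)$. Images carry the subspace topology. *)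

(* Defs.v *)
From Stdlib Require Import Relation_Operators.
From mathcomp Require Import all_boot all_classical.
From mathcomp Require Import topology.

Set Implicit Arguments.
Unset Strict Implicit.
Unset Printing Implicit Defensive.

Local Open Scope classical_set_scope.
Local Open Scope quotient_scope.

(* The topology on sigma types and quotients requires a choiceType of indices;
   classically this is no restriction on the set of vertices. *)
Record quiver := Quiver {
  vertex : choiceType;
  arrow : Type;
  src : arrow -> vertex;
  tgt : arrow -> vertex }.

Definition finite_quiver (G : quiver) : Prop :=
  finite_set [set: vertex G] /\ finite_set [set: arrow G].

Record toprep (G : quiver) := TopRep {
  space :> vertex G -> topologicalType;
  smap : forall a : arrow G, space (src a) -> space (tgt a);
  smap_continuous : forall a, continuous (@smap a) }.

Arguments smap {G} _ a _.

Record subrep (G : quiver) (T : toprep G) := SubRep {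
  subsp :> forall i, set (T i);
  subrep_stable : forall a : arrow G,
    smap T a @` @subsp (src a) `<=` @subsp (tgt a) }.

Arguments subsp {G T} _ i _.

(* The sets [S i], coerced to types, carry the topology induced by [T i]. *)
Section subrep_toprep.
Variables (G : quiver) (T : toprep G) (S : subrep T).

Lemma subrep_mem (a : arrow G) (x : S (src a)) :
  smap T a (set_val x) \in S (tgt a).
Proof.
by apply/mem_set/subrep_stable; exists (set_val x) => //; exact: set_valP.
Qed.

Definition subrep_map (a : arrow G) (x : S (src a)) : S (tgt a) :=
  exist _ (smap T a (set_val x)) (subrep_mem x).

Lemma subrep_map_continuous (a : arrow G) : continuous (@subrep_map a).
Proof.
apply/continuousP => _ [A oA <-].
rewrite -comp_preimage.
have /continuousP : continuous (smap T a \o (@set_val _ (S (src a)))).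
  move=> x; apply: continuous_comp; first exact: initial_continuous.
  exact: smap_continuous.
exact.
Qed.

Definition subrep_toprep : toprep G :=
  @TopRep G (fun i => S i) subrep_map subrep_map_continuous.

End subrep_toprep.

Record toprep_hom (G : quiver) (T U : toprep G) := Hom {
  homf :> forall i, T i -> U i;
  hom_continuous : forall i, continuous (@homf i);
  hom_commute : forall (a : arrow G) (x : T (src a)),
    homf (smap T a x) = smap U a (homf x) }.

Section inclusion.
Variables (G : quiver) (T : toprep G) (S : subrep T).

Lemma subrep_incl_continuous i : continuous (@set_val _ (S i)).
Proof. exact: initial_continuous. Qed.

Definition subrep_incl : toprep_hom (subrep_toprep S) T :=
  @Hom G (subrep_toprep S) T (fun i => @set_val _ (S i)) subrep_incl_continuous
    (fun _ _ => erefl).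

End inclusion.

Section At.
Variables (G : quiver) (T : toprep G).

Definition coprod : topologicalType := {i : vertex G & T i}.

Definition At_gen (u v : coprod) : Prop :=
  exists (a : arrow G) (x : T (src a)),
    u = existT _ (src a) x /\ v = existT _ (tgt a) (smap T a x).

Definition At_rel (u v : coprod) : bool :=
  `[< clos_refl_sym_trans coprod At_gen u v >].

Lemma At_rel_refl : reflexive At_rel.
Proof. by move=> u; apply/asboolP; exact: rst_refl. Qed.

Lemma At_rel_sym : symmetric At_rel.
Proof. by move=> u v; apply/asboolP/asboolP; exact: rst_sym. Qed.

Lemma At_rel_trans : transitive At_rel.
Proof.
by move=> v u w /asboolP uv /asboolP vw; apply/asboolP; exact: rst_trans vw.
Qed.

Definition At_equiv := EquivRel _ At_rel_refl At_rel_sym At_rel_trans.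

Definition At := quotient_topology {eq_quot At_equiv}.

Definition At_class i (x : T i) : At := \pi_At (existT _ i x).

End At.

Section At_map.
Variables (G : quiver) (T U : toprep G) (alpha : toprep_hom T U).

Definition coprod_map (u : coprod T) : coprod U :=
  existT _ (projT1 u) (alpha (projT1 u) (projT2 u)).

(* Defined through a representative; [At_map_class] shows that the choice of
   representative does not matter. *)
Definition At_map (q : At T) : At U := \pi_(At U) (coprod_map (repr q)).

Lemma At_map_pi (u : coprod T) :
  At_map (\pi_(At T) u) = \pi_(At U) (coprod_map u).
Proof.
rewrite /At_map.
have /eqmodP/asboolP : repr (\pi_(At T) u) = u %[mod At T] by rewrite reprK.
move: (repr _) => v; elim=> {v u} [u v [a [x [-> ->]]]|//|u v _ ->//|].
  apply/eqmodP/asboolP/rst_step; exists a, (alpha (src a) x).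
  by rewrite /coprod_map /= hom_commute.
by move=> u v w _ -> _ ->.
Qed.

Lemma At_map_class i (x : T i) : At_map (At_class x) = At_class (alpha i x).
Proof. exact: At_map_pi. Qed.

Lemma At_map_continuous : continuous At_map.
Proof.
apply/quotient_continuous.
have -> : At_map \o \pi_(At T) = \pi_(At U) \o coprod_map.
  by apply/funext => u; exact: At_map_pi.
move=> u; apply: continuous_comp; last exact: pi_continuous.
move: u; apply: (@sigT_continuous _ _ _ (fun i x => existT _ i (alpha i x))).
move=> i x; apply: continuous_comp; last exact: existT_continuous.
exact: hom_continuous.
Qed.

End At_map.

Definition homeomorphic (X Y : topologicalType) : Prop :=
  exists (f : X -> Y) (g : Y -> X),
    [/\ continuous f, continuous g, cancel f g & cancel g f].

(* Main.v *)
Require Import Defs.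
From Stdlib Require Import Relation_Operators.
From mathcomp Require Import all_boot all_classical.
From mathcomp Require Import topology.

(** The idea is that a sub-representation [S] with a complementary
sub-representation is also stable under going backwards along arrows: if
[f_a x] lies in [S] but [x] does not, then [x] lies in the complement, hence
so does [f_a x], a contradiction. Call such an [S] saturated. No generating
pair of the equivalence relation then joins a point of [S] to a point outside
[S], so that [S] is a union of classes of the coproduct ([inside_equiv]).

Everything follows from this. The image of [At S] consists of the classes of
the points of [S] ([range_At_incl]), whence the decomposition of [At T] into
two disjoint images. A chain of generating pairs that joins two points of [S]
never leaves [S], hence is also a chain for [S]; this is injectivity
([At_incl_inj]). Finally, let every [S i] be open. An open set of [At S] pulls
back to an open set of the coproduct of the [S i], hence of the [T i], and
this open set is a union of classes of [T]. So the map [At S -> At T] is open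
([At_incl_open]), and an injective continuous open map is a homeomorphism onto
its image ([open_embedding_homeomorphic]). *)

Local Open Scope classical_set_scope.
Local Open Scope quotient_scope.

Lemma open_embedding_homeomorphic (X Y : topologicalType) (f : X -> Y) :
  continuous f -> injective f -> (forall U, open U -> open (f @` U)) ->
  homeomorphic X (range f).
Proof.
move=> fcont finj fopen.
have frange x : f x \in range f by apply/mem_set; exists x.
pose h (x : X) : range f := exist _ (f x) (frange x).
have preim (y : range f) : exists x, f x = set_val y.
  by have [x _ xy] := set_valP y; exists x.
pose g (y : range f) : X := projT1 (cid (preim y)).
have fg y : f (g y) = set_val y by exact: projT2 (cid (preim y)).
exists h, g; split.
- apply/continuousP => _ [B oB <-].
  by rewrite -comp_preimage; move/continuousP: fcont; exact.
- apply/continuousP => U oU; exists (f @` U); first exact: fopen.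
  apply/seteqP; split => y /=; last by move=> Ugy; exists (g y).
  by move=> [x Ux]; rewrite -fg => /finj <-.
- by move=> x; apply: finj; rewrite fg.
- by move=> y; apply: val_inj; rewrite /= fg.
Qed.

Lemma set_val_open (X : topologicalType) (A : set X) (V : set A) :
  open A -> open V -> open (set_val @` V).
Proof.
move=> oA [B oB <-].
suff -> : set_val @` (set_val @^-1` B : set A) = B `&` A by exact: openI.
apply/seteqP; split=> [_ [x Bx <-]|x [Bx Ax]].
  by split=> //; exact: set_valP.
by exists (exist _ x (mem_set Ax)).
Qed.

(** * Saturated sub-representations *)

Definition saturated {G : quiver} {T : toprep G} (S : subrep T) : Prop :=
  forall (a : arrow G) (x : T (src a)), S (tgt a) (smap T a x) -> S (src a) x.

Lemma complement_saturated (G : quiver) (T : toprep G) (S S' : subrep T) :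
  (forall i, S i `|` S' i = [set: T i]) -> (forall i, S i `&` S' i = set0) ->
  saturated S.
Proof.
move=> cov dis a x Sfx.
have [//|S'x] : (S (src a) `|` S' (src a)) x by rewrite cov.
suff : (S (tgt a) `&` S' (tgt a)) (smap T a x) by rewrite dis.
by split=> //; apply: subrep_stable; exists x.
Qed.

Section saturated.
Context {G : quiver} {T : toprep G} {S : subrep T}.

Local Notation incl := (subrep_incl S).

Definition inside (u : coprod T) : Prop := S (projT1 u) (projT2 u).

Lemma coprod_incl_inj : injective (coprod_map incl).
Proof.
move=> [i x] [j y] E.
have ij : i = j := existT_inj1 E.
by subst j; have /val_inj -> : set_val x = set_val y := existT_inj2 E.
Qed.

Lemma inside_incl (u : coprod (subrep_toprep S)) : inside (coprod_map incl u).
Proof. exact: set_valP. Qed.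

Lemma inside_lift {u : coprod T} : inside u -> exists u', coprod_map incl u' = u.
Proof. by case: u => i x Sx; exists (existT _ i (exist _ x (mem_set Sx))). Qed.

Hypothesis Ssat : saturated S.

Lemma inside_equiv {u v : coprod T} :
  clos_refl_sym_trans _ (@At_gen G T) u v -> inside u <-> inside v.
Proof.
elim=> {u v} [u v [a [x [-> ->]]]|//|u v _ [? ?]|u v w _ [? ?] _ [? ?]].
- by split=> [Sx|]; [apply: subrep_stable; exists x | exact: Ssat].
- by split.
- by split; auto.
Qed.

(** Quantifying over the lifts [u'] and [v'] lets the induction run on the
chain in [T]; the intermediate points of a chain have lifts because
[inside_equiv] keeps the chain in [S]. *)
Lemma equiv_lift {u v : coprod T} :
  clos_refl_sym_trans _ (@At_gen G T) u v ->
  forall u' v', coprod_map incl u' = u -> coprod_map incl v' = v ->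
  clos_refl_sym_trans _ (@At_gen G (subrep_toprep S)) u' v'.
Proof.
elim=> {u v} [u v [a [x [-> ->]]]|u|u v _ IH|u v w uv IHuv _ IHvw] u' v' u'E v'E.
- have Sx : S (src a) x by have := inside_incl u'; rewrite u'E.
  pose x' : subrep_toprep S (src a) := exist _ x (mem_set Sx).
  have -> : u' = existT _ (src a) x' by exact: coprod_incl_inj.
  have -> : v' = existT _ (tgt a) (smap (subrep_toprep S) a x').
    exact: coprod_incl_inj.
  by apply: rst_step; exists a, x'.
- by have -> : u' = v' by [apply: coprod_incl_inj; rewrite u'E]; exact: rst_refl.
- by apply: rst_sym; exact: IH.
- have /(inside_equiv uv)/inside_lift[m mE] : inside u.
    by rewrite -u'E; exact: inside_incl.
  by apply: rst_trans (IHuv _ m _ _) (IHvw m _ _ _).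
Qed.

Lemma At_incl_inj : injective (At_map incl).
Proof.
move=> p q; rewrite -[p]reprK -[q]reprK !At_map_pi => /eqmodP/asboolP pq.
by apply/eqmodP/asboolP; exact: equiv_lift pq _ _ erefl erefl.
Qed.

(** Saturation makes membership in an image independent of the
representative, so that images can be computed in the coproduct. *)
Lemma preimage_At_incl (U : set (At (subrep_toprep S))) :
  \pi_(At T) @^-1` (At_map incl @` U) =
  coprod_map incl @` (\pi_(At (subrep_toprep S)) @^-1` U).
Proof.
apply/seteqP; split=> [u /= [q Uq]|_ [u Uu <-]] /=; last first.
  by exists (\pi u) => //; rewrite At_map_pi.
rewrite -{1}[q]reprK At_map_pi => qu.
have /inside_lift[u' u'E] : inside u.
  by move/eqmodP/asboolP: qu => /inside_equiv [+ _]; apply; exact: inside_incl.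
exists u' => //=.
suff <- : q = \pi u' by [].
by apply: At_incl_inj; rewrite At_map_pi u'E -qu -At_map_pi reprK.
Qed.

Lemma range_At_incl (u : coprod T) :
  range (At_map incl) (\pi_(At T) u) <-> inside u.
Proof.
rewrite -[range _ _]/((_ @^-1` _) u) preimage_At_incl preimage_setT.
split=> [[u' _ <-]|/inside_lift[u' u'E]]; first exact: inside_incl.
by exists u'.
Qed.

Lemma At_incl_open (U : set (At (subrep_toprep S))) :
  (forall i, open (S i)) -> open U -> open (At_map incl @` U).
Proof.
move=> oS oU; change (open (\pi_(At T) @^-1` (At_map incl @` U))).
rewrite preimage_At_incl; apply/sigT_openP => i.
set V := _ @^-1` U.
have -> : existT (space T) i @^-1` (coprod_map incl @` V) =
          set_val @` (existT (space (subrep_toprep S)) i @^-1` V).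
  apply/seteqP; split=> [x /= [[j y] Vy /= E]|_ [x Vx <-]]; last first.
    by exists (existT _ i x).
  have ji : j = i := existT_inj1 E.
  by subst j; exists y => //; exact: existT_inj2 E.
by apply: set_val_open => //; move/sigT_openP: oU; exact.
Qed.

End saturated.

Theorem theorem6p9 (G : quiver) (T : toprep G) (T' T'' : subrep T)
    (finG : finite_quiver G)
    (covT : forall i : vertex G, T' i `|` T'' i = [set: T i])
    (disT : forall i : vertex G, T' i `&` T'' i = set0) :
  [/\ injective (At_map (subrep_incl T')),
      injective (At_map (subrep_incl T'')),
      range (At_map (subrep_incl T')) `|` range (At_map (subrep_incl T'')) = [set: At T] &
      range (At_map (subrep_incl T')) `&` range (At_map (subrep_incl T'')) = set0] /\
  ((forall i : vertex G, open (T' i)) ->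
   homeomorphic (At (subrep_toprep T')) (range (At_map (subrep_incl T')))).
Proof.
have sat' : saturated T' by exact: complement_saturated covT disT.
have sat'' : saturated T''.
  by apply: (@complement_saturated _ _ _ T') => i; rewrite (setUC, setIC).
split; first split.
- exact: At_incl_inj.
- exact: At_incl_inj.
- apply/seteqP; split=> // q _; rewrite -[q]reprK.
  have [Sq|Sq] : (T' (projT1 (repr q)) `|` T'' (projT1 (repr q))) (projT2 (repr q)).
    by rewrite covT.
  + by left; apply/range_At_incl.
  + by right; apply/range_At_incl.
- apply/seteqP; split=> // q; rewrite -[q]reprK.
  move=> [/(range_At_incl sat') T'q /(range_At_incl sat'') T''q].
  by have := conj T'q T''q : (T' _ `&` T'' _) (projT2 (repr q)); rewrite disT.
- move=> oT'; apply: open_embedding_homeomorphic.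
  + exact: At_map_continuous.
  + exact: At_incl_inj.
  + by move=> U; exact: At_incl_open.
Qed.
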